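(* Let $m,n,N\in\mathbb N_0$, let $q\in\mathbb C$ with $q\ne0$, $|q|\ne1$, and let $\alpha,\beta\in\mathbb C$. Take the upper signs throughout or the lower signs throughout; for the upper signs assume $\alpha=-N-1$ (with $\beta$ unrestricted), and for the lower signs assume $\beta=-N-1$ (with $\alpha$ unrestricted). Assume that no denominator below vanishes. (a) If $n\le N$, then $$P_n^{(\alpha,\beta)}\left(\pm\tfrac12(q^{\frac14+\frac m2}+q^{-\frac14-\frac m2})|q\right)=(\pm q^{\frac\alpha2})^n\frac{(\pm q^{\frac{\alpha+1}{2}},\mp q^{\frac{\beta+1}{2}};q^{\frac12})_n}{(q^{\frac12},-q^{\frac{\alpha+\beta+1}{2}};q^{\frac12})_n}R_n\left(q^{-\frac m2}+q^{\frac{m+1}{2}};\pm q^{\frac\alpha2},\pm q^{\frac\beta2},-1,-1|q^{\frac12}\right).$$ (b) If $m\le N$, then $$P_n^{(\alpha,\beta)}\left(\pm\tfrac12(q^{\frac14+\frac m2}+q^{-\frac14-\frac m2})|q\right)=(\pm q^{\frac\alpha2})^n\frac{(\pm q^{\frac{\alpha+1}{2}},\mp q^{\frac{\beta+1}{2}};q^{\frac12})_n}{(q^{\frac12},-q^{\frac{\alpha+\beta+1}{2}};q^{\frac12})_n}R_m\left(q^{-\frac n2}+q^{\frac{\alpha+\beta+n+1}{2}};-1,-1,\pm q^{\frac\alpha2},\pm q^{\frac\beta2}|q^{\frac12}\right).$$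
   Context: Complex powers of $q$: fix a logarithm $\log q$ and set $q^s:=\exp(s\log q)$. Notation: $(a;q)_n:=\prod_{k=0}^{n-1}(1-aq^k)$, and $(a_1,\dots,a_r;q)_n:=\prod_i (a_i;q)_n$; in the statement $\pm a$ denotes a single entry whose sign is the chosen one. Askey--Wilson polynomials: for $x=\frac12(z+z^{-1})$, $z\in\mathbb C\setminus\{0\}$, $$p_n(x;a,b,c,d|q):=a^{-n}(ab,ac,ad;q)_n\sum_{k=0}^n\frac{(q^{-n},q^{n-1}abcd,az,az^{-1};q)_k}{(q,ab,ac,ad;q)_k}q^k,$$ where $(ab;q)_n/(ab;q)_k$ is read as $(abq^k;q)_{n-k}$ (likewise for $ac$, $ad$), so that $p_n$ is always defined. Continuous $q$-Jacobi polynomials: $$P_n^{(\alpha,\beta)}(x|q):=\frac{q^{(\frac{\alpha}{2}+\frac14)n}}{(q,-q^{\frac{\alpha+\beta+1}{2}},-q^{\frac{\alpha+\beta+2}{2}};q)_n}\,p_n\left(x;q^{\frac{\alpha}{2}+\frac14},q^{\frac{\alpha}{2}+\frac34},-q^{\frac{\beta}{2}+\frac14},-q^{\frac{\beta}{2}+\frac34}\big|q\right).$$ $q$-Racah polynomials in base $q$: with $\mu(m)=q^{-m}+q^{m+1}\bar\gamma\bar\delta$, $m,n\in\mathbb N_0$, $$R_n(\mu(m);\bar\alpha,\bar\beta,\bar\gamma,\bar\delta|q):=\sum_{k=0}^{\min(m,n)}\frac{(q^{-n},q^{n+1}\bar\alpha\bar\beta,q^{-m},q^{m+1}\bar\gamma\bar\delta;q)_k}{(q,q\bar\alpha,q\bar\beta\bar\delta,q\bar\gamma;q)_k}q^k,$$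 where one of $\bar\alpha$, $\bar\beta\bar\delta$, $\bar\gamma$ equals $q^{-N-1}$. The notation $R_n(\cdot|q^{1/2})$ means that $q$ is replaced by $q^{1/2}$ throughout. *)

(* Defs.v *)
From mathcomp Require Import all_boot all_order all_algebra.
From mathcomp Require Import all_classical all_reals all_analysis.
From mathcomp Require Import complex.
From mathcomp Require Import ring.

Set Implicit Arguments.
Unset Strict Implicit.
Unset Printing Implicit Defensive.

Import Order.TTheory GRing.Theory Num.Theory.

Local Open Scope ring_scope.

(* The complex field is [R[i]] for [R : realType]. *)

Definition cexp (R : realType) (z : R[i]) : R[i] :=
  let: Complex u v := z in Complex (expR u * cos v) (expR u * sin v).

(* [q^s] for the branch [logq] of the logarithm of [q]. *)
Definition cpow (R : realType) (logq s : R[i]) : R[i] := cexp (s * logq).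

(* (a; q)_n *)
Definition qpoch (F : fieldType) (a q : F) (n : nat) : F :=
  \prod_(k < n) (1 - a * q ^+ k).

(* (a_1, ..., a_r; q)_n *)
Definition qpochs (F : fieldType) (s : seq F) (q : F) (n : nat) : F :=
  \prod_(a <- s) qpoch a q n.

(* The Askey-Wilson sum in terms of [z], where [x = (z + 1/z) / 2].  The
   quotients (ab;q)_n / (ab;q)_k, etc., are read as (ab q^k; q)_(n-k). *)
Definition askey_wilson_z (F : fieldType) (n : nat) (z a b c d q : F) : F :=
  a ^- n *
  \sum_(k < n.+1)
     qpochs [:: q ^- n; q ^ (n%:Z - 1) * a * b * c * d; a * z; a * z^-1] q k
     / qpoch q q k
     * qpochs [:: a * b * q ^+ k; a * c * q ^+ k; a * d * q ^+ k] q (n - k)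
     * q ^+ k.

(* p_n(x; a, b, c, d | q): [z] is one of the two roots of x = (z + 1/z) / 2;
   [askey_wilsonE] shows that the choice is irrelevant. *)
Definition askey_wilson (R : realType) (n : nat) (x a b c d q : R[i]) : R[i] :=
  askey_wilson_z n (x + sqrtC (x ^+ 2 - 1)) a b c d q.

(* P_n^(alpha, beta)(x | q), where q = exp logq. *)
Definition cqJacobi (R : realType) (n : nat) (alpha beta x logq : R[i]) :
    R[i] :=
  let q := cexp logq in
  let qp := cpow logq in
  qp ((alpha / 2 + 1 / 4) * n%:R)
  / qpochs [:: q; - qp ((alpha + beta + 1) / 2); - qp ((alpha + beta + 2) / 2)]
      q n
  * askey_wilson n x (qp (alpha / 2 + 1 / 4)) (qp (alpha / 2 + 3 / 4))
      (- qp (beta / 2 + 1 / 4)) (- qp (beta / 2 + 3 / 4)) q.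

(* mu(m) *)
Definition qRacah_mu (F : fieldType) (c d q : F) (m : nat) : F :=
  q ^- m + q ^+ m.+1 * c * d.

(* The denominator of the k-th term of R_n(mu(m); a, b, c, d | q). *)
Definition qRacah_den (F : fieldType) (a b c d q : F) (k : nat) : F :=
  qpochs [:: q; q * a; q * b * d; q * c] q k.

Definition qRacah_m (F : fieldType) (n m : nat) (a b c d q : F) : F :=
  \sum_(k < (minn m n).+1)
     qpochs [:: q ^- n; q ^+ n.+1 * a * b; q ^- m; q ^+ m.+1 * c * d] q k
     / qRacah_den a b c d q k * q ^+ k.

(* R_n(x; a, b, c, d | q) at a point x of the form mu(m); [qRacahE] shows that
   the choice of such an [m] is irrelevant.  (Junk value if there is none.) *)
Definition qRacah (F : fieldType) (n : nat) (x a b c d q : F) : F :=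
  qRacah_m n (xget 0%N [set m | x = qRacah_mu c d q m]%classic) a b c d q.

Lemma askey_wilson_zV (F : fieldType) n (z a b c d q : F) :
  askey_wilson_z n z^-1 a b c d q = askey_wilson_z n z a b c d q.
Proof.
rewrite /askey_wilson_z; congr (_ * _); apply: eq_bigr => k _.
rewrite invrK; congr (_ / _ * _ * _); rewrite /qpochs !big_cons.
by congr (_ * (_ * _)); rewrite mulrCA.
Qed.

Lemma askey_wilsonE (R : realType) n (z a b c d q : R[i]) : z != 0 ->
  askey_wilson n ((z + z^-1) / 2) a b c d q = askey_wilson_z n z a b c d q.
Proof.
move=> z0; rewrite /askey_wilson.
have two0 : (2 : R[i]) != 0 by rewrite pnatr_eq0.
set x := (z + z^-1) / 2; set r := sqrtC _.
have hr : (x + r - z) * (x + r - z^-1) = 0.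
  have -> : (x + r - z) * (x + r - z^-1) = r ^+ 2 - (x ^+ 2 - 1).
    by rewrite /x; field; rewrite z0.
  by rewrite /r sqrtCK subrr.
move/eqP: hr; rewrite mulf_eq0 !subr_eq0 => /orP[]/eqP -> //.
exact: askey_wilson_zV.
Qed.

Lemma qpoch_qVn_eq0 (F : fieldType) (q : F) m k : q != 0 -> (m < k)%N ->
  qpoch (q ^- m) q k = 0.
Proof.
move=> q0 mk; rewrite /qpoch (bigD1 (Ordinal mk)) //=.
by rewrite mulVf ?expf_neq0 // subrr mul0r.
Qed.

Lemma qpoch_mu (F : fieldType) (c d q : F) m k : q != 0 ->
  qpoch (q ^- m) q k * qpoch (q ^+ m.+1 * c * d) q k =
  \prod_(j < k) (1 - q ^+ j * qRacah_mu c d q m + q ^+ j.*2.+1 * c * d).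
Proof.
move=> q0; rewrite /qpoch -big_split /=; apply: eq_bigr => j _.
have h : q ^- m * q ^+ m.+1 = q by rewrite exprS mulrCA mulVf ?expf_neq0 ?mulr1.
have -> : q ^+ j.*2.+1 = q ^- m * q ^+ m.+1 * q ^+ j * q ^+ j.
  by rewrite h exprS -addnn exprD mulrA.
rewrite /qRacah_mu; ring.
Qed.

Lemma qRacahE (F : fieldType) n m (a b c d q : F) : q != 0 ->
  qRacah n (qRacah_mu c d q m) a b c d q = qRacah_m n m a b c d q.
Proof.
move=> q0.
have full i : qRacah_m n i a b c d q = \sum_(k < n.+1)
    qpoch (q ^- n) q k * qpoch (q ^+ n.+1 * a * b) q k *
    (\prod_(j < k) (1 - q ^+ j * qRacah_mu c d q i + q ^+ j.*2.+1 * c * d))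
    / qRacah_den a b c d q k * q ^+ k.
  pose G k := qpochs
    [:: q ^- n; q ^+ n.+1 * a * b; q ^- i; q ^+ i.+1 * c * d] q k
    / qRacah_den a b c d q k * q ^+ k.
  rewrite /qRacah_m (big_ord_widen n.+1 G) ?ltnS ?geq_minr // big_mkcond /=.
  apply: eq_bigr => k _; rewrite -qpoch_mu //.
  case: ifPn => [_|]; first by rewrite /G /qpochs !big_cons big_nil mulr1 !mulrA.
  rewrite ltnS leq_min -[X in _ && X]ltnS ltn_ord andbT -ltnNge => ik.
  by rewrite (qpoch_qVn_eq0 q0 ik) mul0r mulr0 !mul0r.
rewrite /qRacah !full; case: xgetP => [i _ /= <- //|] /(_ m) /=.
by move=> /(_ erefl).
Qed.

(* Main.v *)
Require Import Defs.
From mathcomp Require Import all_boot all_order all_algebra.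
From mathcomp Require Import all_classical all_reals all_analysis.
From mathcomp Require Import complex.
From mathcomp Require Import ring zify.

(* With [Q = q^(1/2)], [p = q^(1/4)], [A = +-q^(alpha/2)], [B = +-q^(beta/2)]
   and the sign also absorbed into [p], the theorem rests on the quadratic
   transformation
     p_n(x; A p, A p^3, - B p, - B p^3 | q) =
     (- A B Q^(n+1); Q)_n p_n(x; p, A p, - B p, - p | Q).
   For generic [A] and [B] both sides satisfy the same three-term recurrence in
   [n]; scaling [(A, B)] to [(t A, t B)] makes both sides polynomial in [t] (up
   to a power of [t]), which removes the genericity.  At [z = p Q^m] the 4phi3
   series on the right is the q-Racah polynomial of (a), and (b) follows since
   that series is symmetric in the two pairs of data. *)

Import Order.TTheory GRing.Theory Num.Theory.

Local Open Scope ring_scope.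

(** * q-shifted factorials, the Askey-Wilson series and its three-term recurrence in the degree *)

Section QPochhammer.
Variable F : fieldType.
Implicit Types a b c d q z : F.

Lemma qpoch0 a q : qpoch a q 0 = 1.
Proof. by rewrite /qpoch big_ord0. Qed.

Lemma qpochSr a q n : qpoch a q n.+1 = qpoch a q n * (1 - a * q ^+ n).
Proof. by rewrite /qpoch big_ord_recr. Qed.

Lemma qpochSl a q n : qpoch a q n.+1 = (1 - a) * qpoch (a * q) q n.
Proof.
rewrite /qpoch big_ord_recl /= expr0 mulr1; congr (_ * _).
by apply: eq_bigr => i _; rewrite exprS mulrA.
Qed.

Lemma qpochD a q k n :
  qpoch a q (k + n) = qpoch a q k * qpoch (a * q ^+ k) q n.
Proof.
rewrite /qpoch big_split_ord; congr (_ * _); apply: eq_bigr => i _ /=.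
by rewrite exprD mulrA.
Qed.

Lemma qpoch_sqr a q n :
  qpoch (a ^+ 2) (q ^+ 2) n = qpoch a q n * qpoch (- a) q n.
Proof.
rewrite /qpoch -big_split; apply: eq_bigr => i _ /=.
by rewrite -exprM mulnC exprM; ring.
Qed.

(** The two products on the left collect the factors with even and with odd exponents of [q]. *)
Lemma qpoch_bisect a q n :
  qpoch a (q ^+ 2) n * qpoch (a * q) (q ^+ 2) n = qpoch a q (n + n).
Proof.
elim: n => [|n IH]; first by rewrite !qpoch0 mulr1.
rewrite addSn addnS !qpochSr -IH -exprM mul2n -addnn [q ^+ (n + n).+1]exprS.
ring.
Qed.

Lemma qpoch_neq0 a q n :
  (forall j, (j < n)%N -> 1 - a * q ^+ j != 0) -> qpoch a q n != 0.
Proof. by move=> h; apply/prodf_neq0 => i _; apply: h. Qed.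

Lemma qpochs_cons a s q n : qpochs (a :: s) q n = qpoch a q n * qpochs s q n.
Proof. by rewrite /qpochs big_cons. Qed.

Lemma qpochs_nil q n : qpochs [::] q n = 1.
Proof. by rewrite /qpochs big_nil. Qed.

Definition qpochsE := (qpochs_cons, qpochs_nil, mulr1).

Lemma qpochs_neq0_le s q k n : (k <= n)%N ->
  qpochs s q n != 0 -> qpochs s q k != 0.
Proof.
move=> /subnKC <-; rewrite /qpochs !prodf_seq_neq0 => /allP h.
apply/allP => a /h /=; rewrite qpochD mulf_eq0 negb_or => /andP[].
by [].
Qed.

Lemma qpochs0 s q : qpochs s q 0 = 1.
Proof. by rewrite /qpochs big1 // => a _; apply: qpoch0. Qed.

Lemma qpochs2 a b q n : qpochs [:: a; b] q n = qpoch a q n * qpoch b q n.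
Proof. by rewrite !qpochsE. Qed.

(** The [z]-free part of the k-th term of the Askey-Wilson 4phi3 series; $q^{n-1}$ is written
    [q ^+ n / q] to keep natural exponents. *)
Definition aw_coef n k a b c d q :=
  qpochs [:: q ^- n; a * b * c * d * q ^+ n / q] q k
  / qpochs [:: q; a * b; a * c; a * d] q k * q ^+ k.

(** The Askey-Wilson polynomial normalised to the value 1 at [z = a] (for nonzero [a]): there
    $(a/z;q)_k$ vanishes for $k>0$. *)
Definition aw_phi n z a b c d q :=
  \sum_(k < n.+1) aw_coef n k a b c d q * qpochs [:: a * z; a / z] q k.

Lemma askey_wilson_phiE n z a b c d q :
  q != 0 -> qpochs [:: a * b; a * c; a * d] q n != 0 ->
  askey_wilson_z n z a b c d q =
  a ^- n * qpochs [:: a * b; a * c; a * d] q n * aw_phi n z a b c d q.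
Proof.
move=> q0 h; rewrite /askey_wilson_z -[RHS]mulrA; congr (_ * _).
rewrite /aw_phi mulr_sumr; apply: eq_bigr => k _.
have kn : (k <= n)%N by rewrite -ltnS.
have e x : qpoch x q n = qpoch x q k * qpoch (x * q ^+ k) q (n - k).
  by rewrite -qpochD subnKC.
have := qpochs_neq0_le _ _ _ _ kn h.
rewrite /aw_coef !qpochsE !e !mulf_eq0 !negb_or.
move=> /and3P[h1 h2 h3].
rewrite expfzDr // -exprnP exprN1.
have -> : q ^+ n / q * a * b * c * d = a * b * c * d * q ^+ n / q by field.
(* [q] may be a root of unity here; since the inverse of 0 is 0, both sides then vanish. *)
have [-> | dq] := eqVneq (qpoch q q k) 0.
  by rewrite !(mul0r, invr0, mulr0).
by field; rewrite h1 h2 h3.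
Qed.

(** The added terms contain $(q^{-n};q)_k=0$ with $k>n$. This puts the series of degrees $n-1$, $n$,
    $n+1$ over one range of summation. *)
Lemma aw_phiE K n z a b c d q : q != 0 -> (n < K)%N ->
  aw_phi n z a b c d q =
  \sum_(k < K) aw_coef n k a b c d q * qpochs [:: a * z; a / z] q k.
Proof.
move=> q0 nK; rewrite /aw_phi.
rewrite (big_ord_widen K
  (fun k => aw_coef n k a b c d q * qpochs [:: a * z; a / z] q k)) //.
rewrite big_mkcond /=; apply: eq_bigr => k _.
case: ifPn => //; rewrite -leqNgt => nk.
by rewrite /aw_coef !qpochs_cons qpoch_qVn_eq0 // !mul0r.
Qed.

(* [u] stands for [q ^ n]. *)
Definition aw_up u a b c d q :=
  (1 - a * b * u) * (1 - a * c * u) * (1 - a * d * u)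
  * (1 - a * b * c * d * u / q)
  / (a * (1 - a * b * c * d * u ^+ 2 / q) * (1 - a * b * c * d * u ^+ 2)).

(** With $A_n$ for [aw_up] and $C_n$ for [aw_down], these are the classical coefficients in
    $2x\,\phi_n=A_n\phi_{n+1}+(a+a^{-1}-A_n-C_n)\phi_n+C_n\phi_{n-1}$. *)
Definition aw_down u a b c d q :=
  a * (1 - u) * (1 - b * c * u / q) * (1 - b * d * u / q)
  * (1 - c * d * u / q)
  / ((1 - a * b * c * d * u ^+ 2 / q ^+ 2) * (1 - a * b * c * d * u ^+ 2 / q)).

Lemma qpoch_shift a q n :
  (1 - a) * qpoch (a * q) q n = qpoch a q n * (1 - a * q ^+ n).
Proof. by rewrite -qpochSl qpochSr. Qed.

(* [P], [W], [D] stand for [(q^-n; q)_j], [(a b c d q^(n-1); q)_j] and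
   [(q, a b, a c, a d; q)_j], [u] for [q^n], [v] for [q^j]. *)
Lemma aw_rational a b c d q u v P W D (s := a * b * c * d) :
  q != 0 -> a != 0 -> u != 0 -> v != 0 -> D != 0 ->
  1 - s * u / q != 0 -> 1 - u != 0 ->
  1 - s * u ^+ 2 / q ^+ 2 != 0 -> 1 - s * u ^+ 2 / q != 0 ->
  1 - s * u ^+ 2 != 0 ->
  1 - q * v != 0 -> 1 - a * b * v != 0 -> 1 - a * c * v != 0 ->
  1 - a * d * v != 0 ->
  let D' := D * (1 - q * v) * (1 - a * b * v) * (1 - a * c * v)
            * (1 - a * d * v) in
  let t := P * (1 - v / u) * (W * (1 - s * u / q * v)) / D' * (q * v) in
  aw_up u a b c d q
  * ((1 - (q * u)^-1) * P
     * (W * (1 - s * u / q * v) / (1 - s * u / q) * (1 - s * u * v))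
     / D' * (q * v) - t)
  - aw_down u a b c d q
    * (t - P * (1 - v / u) / (1 - u^-1) * (1 - q * v / u)
           * ((1 - s * u / q ^+ 2) * W) / D' * (q * v)) =
  t * (1 - q * v) * (1 - a ^+ 2 * (q * v)) / (a * (q * v))
  - P * W / D * v / (a * v).
Proof.
rewrite /aw_up /aw_down /s /=.
move=> q0 a0 u0 v0 D0 h3 u1 h2 h1 h0 hq hb hc hd.
have k3 : q - a * b * c * d * u != 0.
  by apply: contra_neq h3 => e; rewrite -[1](divff q0) -mulrBl e mul0r.
have k1 : q - a * b * c * d * u ^+ 2 != 0.
  by apply: contra_neq h1 => e; rewrite -[1](divff q0) -mulrBl e mul0r.
have k2 : q ^+ 2 - a * b * c * d * u ^+ 2 != 0.
  apply: contra_neq h2 => e.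
  by rewrite -[1](divff (expf_neq0 2 q0)) -mulrBl e mul0r.
field.
by rewrite v0 a0 D0 q0 hd hc hb hq u0 -oppr_eq0 opprB u1 k1 k2 k3 h0.
Qed.

(** This is the recurrence read off at the basis element $(az,a/z;q)_{j+1}$. All coefficients
    involved are rational multiples of common factorials, so that it reduces to [aw_rational]. *)
Lemma aw_coef_rec n j a b c d q (s := a * b * c * d) (u := q ^+ n) :
  q != 0 -> a != 0 -> ((0 < n)%N -> 1 - u != 0) -> 1 - s * u / q != 0 ->
  1 - s * u ^+ 2 / q ^+ 2 != 0 -> 1 - s * u ^+ 2 / q != 0 ->
  1 - s * u ^+ 2 != 0 ->
  qpochs [:: q; a * b; a * c; a * d] q j.+1 != 0 ->
  aw_up u a b c d q * (aw_coef n.+1 j.+1 a b c d q - aw_coef n j.+1 a b c d q)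
  - aw_down u a b c d q
    * (aw_coef n j.+1 a b c d q - aw_coef n.-1 j.+1 a b c d q) =
  aw_coef n j.+1 a b c d q * (1 - q ^+ j.+1) * (1 - a ^+ 2 * q ^+ j.+1)
    / (a * q ^+ j.+1) - aw_coef n j a b c d q / (a * q ^+ j).
Proof.
move=> q0 a0 u1 h3 h2 h1 h0.
have u0 : u != 0 by rewrite expf_neq0.
have v0 : q ^+ j != 0 by rewrite expf_neq0.
pose D := qpochs [:: q; a * b; a * c; a * d] q j.
have -> : qpochs [:: q; a * b; a * c; a * d] q j.+1 =
    D * (1 - q * q ^+ j) * (1 - a * b * q ^+ j) * (1 - a * c * q ^+ j)
    * (1 - a * d * q ^+ j).
  by rewrite /D !qpochsE !qpochSr; ring.
rewrite !mulf_eq0 !negb_or => /andP[/andP[/andP[/andP[D0 hq] hb] hc] hd].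
pose P := qpoch u^-1 q j; pose W := qpoch (s * u / q) q j.
pose D' := D * (1 - q * q ^+ j) * (1 - a * b * q ^+ j) * (1 - a * c * q ^+ j)
    * (1 - a * d * q ^+ j).
have eD : qpochs [:: q; a * b; a * c; a * d] q j.+1 = D'.
  by rewrite /D' /D !qpochsE !qpochSr; ring.
have e0 : aw_coef n j a b c d q = P * W / D * q ^+ j.
  by rewrite /aw_coef -/D qpochs2.
have e1 : aw_coef n j.+1 a b c d q = P * (1 - q ^+ j / u)
    * (W * (1 - s * u / q * q ^+ j)) / D' * (q * q ^+ j).
  rewrite /aw_coef eD qpochs2 !(qpochSr _ _ j) exprS.
  by rewrite -/s -/u -/P -/W (mulrC u^-1).
have e2 : aw_coef n.+1 j.+1 a b c d q = (1 - (q * u)^-1) * P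
     * (W * (1 - s * u / q * q ^+ j) / (1 - s * u / q) * (1 - s * u * q ^+ j))
     / D' * (q * q ^+ j).
  rewrite /aw_coef eD qpochs2 qpochSl qpochSr 2!exprS.
  have -> : (q * q ^+ n)^-1 * q = u^-1 by rewrite invfM mulrAC mulVf ?mul1r.
  have -> : a * b * c * d * (q * q ^+ n) / q = s * u.
    by rewrite mulrCA mulrC mulKf.
  (* Moving the argument of the factorial from [s * u / q] to [s * u] introduces the divisor
     [1 - s * u / q]. *)
  congr (_ * _ * (_ * _) / _ * _); apply: (mulfI h3).
  have := qpoch_shift (s * u / q) q j; rewrite divfK // => ->.
  by rewrite mulrCA divff ?mulr1.
(* For [n = 0] one has [u = 1], and the form [e3] of the lower coefficient would divide by 0.
   Instead [aw_down] vanishes, and so does [P] unless [j = 0]. *)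
case: (posnP n) => [n0|n_gt0].
  have -> : aw_down u a b c d q = 0.
    by rewrite /aw_down /u n0 expr0 subrr mulr0 !mul0r.
  rewrite mul0r subr0 e0 e1 e2.
  case: (posnP j) => [j0|j_gt0]; last first.
    have -> : P = 0.
      by rewrite /P /u n0 expr0 invr1 -(prednK j_gt0) qpochSl subrr mul0r.
    by rewrite !(mul0r, mulr0, subrr).
  rewrite /P /W /D' /D /aw_up j0 qpochs0 !qpoch0 expr1 expr0.
  move: hq hb hc hd; rewrite j0 expr0 !mulr1 => hq hb hc hd.
  rewrite /u n0 expr0 expr1n !mulr1 -/s in h3 h2 h1 h0 *.
  have k3 : q - s != 0.
    by apply: contra_neq h3 => e; rewrite -[1](divff q0) -mulrBl e mul0r.
  by field; rewrite a0 oner_neq0 q0 hd hc hb hq k3 h0.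
have e3 : aw_coef n.-1 j.+1 a b c d q = P * (1 - q ^+ j / u) / (1 - u^-1)
     * (1 - q * q ^+ j / u) * ((1 - s * u / q ^+ 2) * W) / D' * (q * q ^+ j).
  have u1' : 1 - u^-1 != 0.
    by rewrite -(divff u0) -{2}[u^-1]mul1r -mulrBl mulf_neq0 ?invr_eq0 // -opprB
      oppr_eq0 u1.
  rewrite /aw_coef eD qpochs2 qpochSr qpochSl exprS.
  have -> : q ^- n.-1 = u^-1 * q.
    by rewrite /u -{2}(prednK n_gt0) exprS invfM mulrAC mulVf ?mul1r.
  have -> : a * b * c * d * q ^+ n.-1 / q = s * u / q ^+ 2.
    by rewrite /u -{2}(prednK n_gt0) exprS /s; field; rewrite q0.
  have -> : s * u / q ^+ 2 * q = s * u / q by field.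
  congr (_ * _ * _ / _ * _); last by rewrite -(mulrA u^-1) mulrC.
  apply: (mulfI u1'); rewrite mulrA qpoch_shift (mulrC u^-1).
  by rewrite mulrAC divff ?mul1r.
rewrite e0 e1 e2 e3 [q ^+ j.+1]exprS.
by apply: aw_rational; rewrite // u1.
Qed.

(* At [n = 0] the junk value [n.-1 = 0] is harmless, as [aw_down] vanishes. *)
Lemma aw_phi_rec n z a b c d q (s := a * b * c * d) (u := q ^+ n) :
  q != 0 -> a != 0 -> z != 0 -> ((0 < n)%N -> 1 - u != 0) ->
  1 - s * u / q != 0 ->
  1 - s * u ^+ 2 / q ^+ 2 != 0 -> 1 - s * u ^+ 2 / q != 0 ->
  1 - s * u ^+ 2 != 0 ->
  qpochs [:: q; a * b; a * c; a * d] q n.+1 != 0 ->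
  aw_up u a b c d q * (aw_phi n.+1 z a b c d q - aw_phi n z a b c d q)
  - aw_down u a b c d q * (aw_phi n z a b c d q - aw_phi n.-1 z a b c d q) =
  (z + z^-1 - a - a^-1) * aw_phi n z a b c d q.
Proof.
move=> q0 a0 z0 u1 h3 h2 h1 h0 hD.
pose f k := qpochs [:: a * z; a / z] q k.
(* In the basis [f], multiplication by $z+z^{-1}-a-a^{-1}$ involves only [f k] and [f k.+1]. *)
have fS k : (z + z^-1 - a - a^-1) * f k =
    (f k * (1 - q ^+ k) * (1 - a ^+ 2 * q ^+ k) - f k.+1) / (a * q ^+ k).
  rewrite /f !qpochs2 !qpochSr.
  have v0 : q ^+ k != 0 by rewrite expf_neq0.
  by field; rewrite v0 a0 z0.
have rE : (z + z^-1 - a - a^-1) * aw_phi n z a b c d q =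
    \sum_(k < n.+1) (aw_coef n k.+1 a b c d q * (1 - q ^+ k.+1)
      * (1 - a ^+ 2 * q ^+ k.+1) / (a * q ^+ k.+1)
      - aw_coef n k a b c d q / (a * q ^+ k)) * f k.+1.
  transitivity (\sum_(k < n.+2) aw_coef n k a b c d q * (1 - q ^+ k)
      * (1 - a ^+ 2 * q ^+ k) / (a * q ^+ k) * f k
      - \sum_(k < n.+1) aw_coef n k a b c d q / (a * q ^+ k) * f k.+1).
    (* The extra term contains $(q^{-n};q)_{n+1}=0$. *)
    have -> : \sum_(k < n.+1) aw_coef n k a b c d q / (a * q ^+ k) * f k.+1
        = \sum_(k < n.+2) aw_coef n k a b c d q / (a * q ^+ k) * f k.+1.
      rewrite [RHS]big_ord_recr /= {3}/aw_coef qpochs2 qpoch_qVn_eq0 //.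
      by rewrite !mul0r addr0.
    rewrite (@aw_phiE n.+2) // -sumrB mulr_sumr; apply: eq_bigr => k _.
    by rewrite mulrCA fS; ring.
  (* The factor [1 - q ^+ k] removes the term [k = 0], so both sums now run over [f k.+1]. *)
  rewrite big_ord_recl expr0 subrr mulr0 !mul0r add0r -sumrB.
  by apply: eq_bigr => k _; rewrite -mulrBl.
(* The terms of index 0 are the same in all degrees and cancel in the differences. *)
have c0 i : aw_coef i 0 a b c d q = 1.
  by rewrite /aw_coef !qpochs0 expr0 divr1 mulr1.
rewrite rE !(@aw_phiE n.+2) //; last by rewrite ltnS leqW // leq_pred.
rewrite !(big_ord_recl n.+1) !c0.
have E (x y w : F) : x + y - (x + w) = y - w by ring.
rewrite !E -!sumrB !mulr_sumr -sumrB; apply: eq_bigr => k _.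
rewrite lift0 -aw_coef_rec ?(qpochs_neq0_le _ _ _ _ _ hD) // -/(f _) -/u.
ring.
Qed.
End QPochhammer.

(** * The quadratic transformation for generic [A] and [B] *)

Section Quadratic.
Variable F : fieldType.
Implicit Types p A B u z : F.

Section Coefficients.
Variables p A B u : F.
Hypotheses (p0 : p != 0) (A0 : A != 0).
Hypotheses (h0 : 1 - A * B * u ^+ 2 != 0) (h0' : 1 + A * B * u ^+ 2 != 0).
Hypotheses (h1 : 1 - A * B * u ^+ 2 * p ^+ 2 != 0)
           (h1' : 1 + A * B * u ^+ 2 * p ^+ 2 != 0).
Hypotheses (h2 : 1 - A * B * u ^+ 2 * p ^+ 4 != 0)
           (h2' : 1 + A * B * u ^+ 2 * p ^+ 4 != 0).

Let E0 : 1 - A ^+ 2 * B ^+ 2 * u ^+ 4 != 0.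
Proof.
have -> : 1 - A ^+ 2 * B ^+ 2 * u ^+ 4 =
  (1 - A * B * u ^+ 2) * (1 + A * B * u ^+ 2) by ring.
by rewrite mulf_neq0.
Qed.

Let E1 : 1 - A ^+ 2 * B ^+ 2 * u ^+ 4 * p ^+ 4 != 0.
Proof.
have -> : 1 - A ^+ 2 * B ^+ 2 * u ^+ 4 * p ^+ 4 =
  (1 - A * B * u ^+ 2 * p ^+ 2) * (1 + A * B * u ^+ 2 * p ^+ 2) by ring.
by rewrite mulf_neq0.
Qed.

Let E2 : 1 - A ^+ 2 * B ^+ 2 * u ^+ 4 * p ^+ 8 != 0.
Proof.
have -> : 1 - A ^+ 2 * B ^+ 2 * u ^+ 4 * p ^+ 8 =
  (1 - A * B * u ^+ 2 * p ^+ 4) * (1 + A * B * u ^+ 2 * p ^+ 4) by ring.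
by rewrite mulf_neq0.
Qed.

(** [up2] and [down2] belong to the base $q=p^4$, where $q^n=u^2$; [up1] and [down1] belong to the
    base $Q=p^2$, where $Q^n=u$. *)
Notation up2 :=
  (aw_up F (u ^+ 2) (A * p) (A * p ^+ 3) (- B * p) (- B * p ^+ 3) (p ^+ 4)).
Notation down2 :=
  (aw_down F (u ^+ 2) (A * p) (A * p ^+ 3) (- B * p) (- B * p ^+ 3) (p ^+ 4)).
Notation up1 := (aw_up F u p (A * p) (- B * p) (- p) (p ^+ 2)).
Notation down1 := (aw_down F u p (A * p) (- B * p) (- p) (p ^+ 2)).

Let coefE :
  [/\ up2 = (1 - A ^+ 2 * u ^+ 2 * p ^+ 4) * (1 + A * B * u ^+ 2 * p ^+ 2)
       * (1 + A * B * u ^+ 2 * p ^+ 4) * (1 - A ^+ 2 * B ^+ 2 * u ^+ 2 * p ^+ 4)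
       / (A * p * (1 - A ^+ 2 * B ^+ 2 * u ^+ 4 * p ^+ 4)
          * (1 - A ^+ 2 * B ^+ 2 * u ^+ 4 * p ^+ 8)),
   down2 = A * p * (1 - u ^+ 2) * (1 + A * B * u ^+ 2)
       * (1 + A * B * u ^+ 2 * p ^+ 2) * (1 - B ^+ 2 * u ^+ 2)
       / ((1 - A ^+ 2 * B ^+ 2 * u ^+ 4)
          * (1 - A ^+ 2 * B ^+ 2 * u ^+ 4 * p ^+ 4)),
   up1 = (1 - A * u * p ^+ 2) * (1 + B * u * p ^+ 2) * (1 + u * p ^+ 2)
       * (1 - A * B * u * p ^+ 2)
       / (p * (1 - A * B * u ^+ 2 * p ^+ 2) * (1 - A * B * u ^+ 2 * p ^+ 4))
   & down1 = p * (1 - u) * (1 + A * B * u) * (1 + A * u) * (1 - B * u)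
       / ((1 - A * B * u ^+ 2) * (1 - A * B * u ^+ 2 * p ^+ 2)) ].
Proof.
rewrite /aw_up /aw_down; split; congr (_ / _); field; rewrite ?p0 //.
Qed.

(** The quotient [up1 / up2] is the ratio of consecutive normalising factors [rho] below. With
    [down_ratio] and [diagonal_eq], this turns the recurrence in base $Q$ into the one in base
    $q$. *)
Lemma up_ratio :
  up2 * (A * (1 + B * u * p ^+ 2) * (1 + u * p ^+ 2)) =
  up1 * ((1 + A * u * p ^+ 2) * (1 + A * B * u * p ^+ 2)).
Proof.
case: coefE => -> _ -> _; field.
by rewrite h2 h1 p0 exprMn E2 E1 A0.
Qed.

Lemma down_ratio :
  down2 * ((1 + A * u) * (1 + A * B * u)) =
  down1 * (A * (1 + B * u) * (1 + u)).
Proof.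
case: coefE => _ -> _ ->; field.
by rewrite h1 h0 exprMn E1 E0.
Qed.

Lemma diagonal_eq :
  A * p + (A * p)^-1 - up2 - down2 = p + p^-1 - up1 - down1.
Proof.
case: coefE => -> -> -> ->; field.
by rewrite h1 h0 h2 p0 exprMn E1 E0 E2 A0.
Qed.
End Coefficients.

Variables p A B z : F.
Hypotheses (p0 : p != 0) (A0 : A != 0) (z0 : z != 0).
Let Q := p ^+ 2.
Hypothesis Q1 : forall j, 1 - Q ^+ j.+1 != 0.
(** Bounding the exponents by [M] makes the excluded parameters the zeros of a single polynomial, as
    the later density argument requires. The squares control both signs at once. *)
Variable M : nat.
Hypothesis hA : forall j, (j <= M)%N -> 1 - (A * Q ^+ j) ^+ 2 != 0.
Hypothesis hB : forall j, (j <= M)%N -> 1 - (B * Q ^+ j) ^+ 2 != 0.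
Hypothesis hAB : forall j, (j <= M)%N -> 1 - (A * B * Q ^+ j) ^+ 2 != 0.

Let le_M n : (n.*2 <= M)%N -> (n <= M)%N.
Proof. by apply: leq_trans; rewrite -addnn leq_addr. Qed.

Let Q0 : Q != 0. Proof. by rewrite expf_neq0. Qed.

(** The conclusion is a product of types, which [rewrite] treats as a pair of rules. *)
Let sqr_neq0 (x : F) : 1 - x ^+ 2 != 0 -> (1 - x != 0) * (1 + x != 0).
Proof.
have -> : 1 - x ^+ 2 = (1 - x) * (1 + x) by ring.
by rewrite mulf_eq0 negb_or => /andP[-> ->].
Qed.

Let T n :=
  aw_phi F n z (A * p) (A * p ^+ 3) (- B * p) (- B * p ^+ 3) (p ^+ 4).
Let S n := aw_phi F n z p (A * p) (- B * p) (- p) Q.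
(** The solution of the first-order recurrence dictated by [up_ratio], with value 1 at [n = 0]. *)
Let rho n := A ^+ n * qpochs [:: - B * Q; - Q] Q n
             / qpochs [:: - A * Q; - A * B * Q] Q n.

Let Q1' j : 1 + Q ^+ j.+1 != 0.
Proof.
have := Q1 (2 * j.+1).-1; rewrite prednK ?muln_gt0 // mulnC exprM.
by move=> /sqr_neq0 ->.
Qed.

Let one_subN_shift (x : F) j : 1 - - x * Q * Q ^+ j = 1 + x * Q ^+ j.+1.
Proof. by rewrite exprS; ring. Qed.

Let dS_neq0 n : (n < M)%N ->
  qpochs [:: Q; p * (A * p); p * (- B * p); p * - p] Q n.+1 != 0.
Proof.
move=> nM; rewrite !qpochsE !mulf_neq0 //; apply: qpoch_neq0 => j jn.
- by rewrite -exprS.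
- have -> : p * (A * p) * Q ^+ j = A * Q ^+ j.+1 by rewrite exprS /Q; ring.
  by rewrite sqr_neq0 // hA // (leq_trans jn).
- have -> : p * (- B * p) * Q ^+ j = - (B * Q ^+ j.+1).
    by rewrite exprS /Q; ring.
  by rewrite opprK sqr_neq0 // hB // (leq_trans jn).
- have -> : p * - p * Q ^+ j = - Q ^+ j.+1 by rewrite exprS /Q; ring.
  by rewrite opprK.
Qed.

Let dT_neq0 n : (n.+1.*2 <= M)%N ->
  qpochs [:: p ^+ 4; A * p * (A * p ^+ 3); A * p * (- B * p);
             A * p * (- B * p ^+ 3)] (p ^+ 4) n.+1 != 0.
Proof.
have e4 j : (p ^+ 4) ^+ j = Q ^+ (j + j).
  by rewrite /Q -!exprM; congr (_ ^+ _); lia.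
move=> nM; rewrite !qpochsE !mulf_neq0 //; apply: qpoch_neq0 => j jn.
- by rewrite -exprS e4 addSn; apply: Q1.
- have -> : A * p * (A * p ^+ 3) * (p ^+ 4) ^+ j = (A * Q ^+ j.+1) ^+ 2.
    by rewrite e4 [Q ^+ j.+1]exprS exprD /Q; ring.
  by apply: hA; lia.
- have -> : A * p * (- B * p) * (p ^+ 4) ^+ j = - (A * B * Q ^+ (j + j).+1).
    by rewrite e4 [Q ^+ _.+1]exprS /Q; ring.
  by rewrite opprK sqr_neq0 // hAB //; lia.
- have -> : A * p * (- B * p ^+ 3) * (p ^+ 4) ^+ j =
      - (A * B * Q ^+ (j + j).+2).
    by rewrite e4 [Q ^+ _.+2]exprS [Q ^+ _.+1]exprS /Q; ring.
  by rewrite opprK sqr_neq0 // hAB //; lia.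
Qed.

Let up1 n := aw_up F (Q ^+ n) p (A * p) (- B * p) (- p) Q.
Let down1 n := aw_down F (Q ^+ n) p (A * p) (- B * p) (- p) Q.
Let up2 n := aw_up F ((Q ^+ n) ^+ 2) (A * p) (A * p ^+ 3) (- B * p)
  (- B * p ^+ 3) (p ^+ 4).
Let down2 n := aw_down F ((Q ^+ n) ^+ 2) (A * p) (A * p ^+ 3) (- B * p)
  (- B * p ^+ 3) (p ^+ 4).

(** The product of the four parameters is $ABQ^2$ here and $(ABQ^2)^2$ in [Trec], so [hAB] covers
    the denominators of the recurrence coefficients. *)
Let Srec n : (n.+1.*2 <= M)%N ->
  up1 n * (S n.+1 - S n) - down1 n * (S n - S n.-1) =
  (z + z^-1 - p - p^-1) * S n.
Proof.
move=> nM; apply: aw_phi_rec => //.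
- by case: n {nM} => // n _; apply: Q1.
- have -> : p * (A * p) * (- B * p) * - p * Q ^+ n / Q = A * B * Q ^+ n.+1.
    by rewrite [Q ^+ n.+1]exprS /Q; field.
  by rewrite sqr_neq0 // hAB //; lia.
- have -> : p * (A * p) * (- B * p) * - p * (Q ^+ n) ^+ 2 / Q ^+ 2 =
      A * B * Q ^+ (n + n) by rewrite exprD /Q; field.
  by rewrite sqr_neq0 // hAB //; lia.
- have -> : p * (A * p) * (- B * p) * - p * (Q ^+ n) ^+ 2 / Q =
      A * B * Q ^+ (n + n).+1 by rewrite [Q ^+ (n + n).+1]exprS exprD /Q; field.
  by rewrite sqr_neq0 // hAB //; lia.
- have -> : p * (A * p) * (- B * p) * - p * (Q ^+ n) ^+ 2 =
      A * B * Q ^+ (n + n).+2.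
    by rewrite [Q ^+ _.+2]exprS [Q ^+ _.+1]exprS exprD /Q; ring.
  by rewrite sqr_neq0 // hAB //; lia.
- by apply: dS_neq0; lia.
Qed.

Let Trec n : (n.+1.*2 <= M)%N ->
  up2 n * (T n.+1 - T n) - down2 n * (T n - T n.-1) =
  (z + z^-1 - A * p - (A * p)^-1) * T n.
Proof.
have e4 : (p ^+ 4) ^+ n = (Q ^+ n) ^+ 2.
  by rewrite /Q -!exprM; congr (_ ^+ _); lia.
move=> nM; rewrite /up2 /down2 -e4; apply: aw_phi_rec; rewrite ?e4 //.
- by rewrite expf_neq0.
- by rewrite mulf_neq0.
- by case: n {nM e4} => // n _; rewrite -exprM muln2; apply: Q1.
- have -> : A * p * (A * p ^+ 3) * (- B * p) * (- B * p ^+ 3) * (Q ^+ n) ^+ 2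
      / p ^+ 4 = (A * B * Q ^+ n.+1) ^+ 2 by rewrite [Q ^+ n.+1]exprS /Q; field.
  by rewrite hAB //; lia.
- have -> : A * p * (A * p ^+ 3) * (- B * p) * (- B * p ^+ 3)
      * ((Q ^+ n) ^+ 2) ^+ 2 / (p ^+ 4) ^+ 2 = (A * B * Q ^+ (n + n)) ^+ 2.
    by rewrite exprD /Q; field.
  by rewrite hAB //; lia.
- have -> : A * p * (A * p ^+ 3) * (- B * p) * (- B * p ^+ 3)
      * ((Q ^+ n) ^+ 2) ^+ 2 / p ^+ 4 = (A * B * Q ^+ (n + n).+1) ^+ 2.
    by rewrite [Q ^+ (n + n).+1]exprS exprD /Q; field.
  by rewrite hAB //; lia.
- have -> : A * p * (A * p ^+ 3) * (- B * p) * (- B * p ^+ 3)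
      * ((Q ^+ n) ^+ 2) ^+ 2 = (A * B * Q ^+ (n + n).+2) ^+ 2.
    by rewrite [Q ^+ _.+2]exprS [Q ^+ _.+1]exprS exprD /Q; ring.
  by rewrite hAB //; lia.
- exact: dT_neq0.
Qed.

Let T0 : T 0 = 1.
Proof. by rewrite /T /aw_phi big_ord1 /aw_coef !qpochs0 expr0 divr1 !mulr1. Qed.

Let S0 : S 0 = 1.
Proof. by rewrite /S /aw_phi big_ord1 /aw_coef !qpochs0 expr0 divr1 !mulr1. Qed.

Let rhoS n : (n.+1.*2 <= M)%N ->
  rho n.+1 * ((1 + A * Q ^+ n.+1) * (1 + A * B * Q ^+ n.+1)) =
  rho n * (A * (1 + B * Q ^+ n.+1) * (1 + Q ^+ n.+1)).
Proof.
move=> nM; rewrite /rho !qpochs2 !qpochSr !one_subN_shift.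
have -> : 1 - - Q * Q ^+ n = 1 + Q ^+ n.+1 by rewrite exprS; ring.
have -> : 1 - - A * B * Q * Q ^+ n = 1 + A * B * Q ^+ n.+1.
  by rewrite exprS; ring.
have hA' : 1 + A * Q ^+ n.+1 != 0 by rewrite sqr_neq0 // hA //; lia.
have hAB' : 1 + A * B * Q ^+ n.+1 != 0 by rewrite sqr_neq0 // hAB //; lia.
have dA : qpoch (- A * Q) Q n != 0.
  apply: qpoch_neq0 => j jn; rewrite one_subN_shift.
  by rewrite sqr_neq0 // hA //; lia.
have dAB : qpoch (- A * B * Q) Q n != 0.
  apply: qpoch_neq0 => j jn; rewrite (mulNr A) one_subN_shift.
  by rewrite sqr_neq0 // hAB //; lia.
rewrite [A ^+ n.+1]exprS; field.
by rewrite dAB dA hAB' hA'.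
Qed.

Let AB_neq0 n : (n.+1.*2 <= M)%N ->
  [/\ (1 - A * B * (Q ^+ n) ^+ 2 != 0) * (1 + A * B * (Q ^+ n) ^+ 2 != 0),
      (1 - A * B * (Q ^+ n) ^+ 2 * p ^+ 2 != 0)
      * (1 + A * B * (Q ^+ n) ^+ 2 * p ^+ 2 != 0)
    & (1 - A * B * (Q ^+ n) ^+ 2 * p ^+ 4 != 0)
      * (1 + A * B * (Q ^+ n) ^+ 2 * p ^+ 4 != 0)].
Proof.
move=> nM.
have e0 : A * B * (Q ^+ n) ^+ 2 = A * B * Q ^+ (n + n).
  by rewrite exprD expr2.
have e1 : A * B * (Q ^+ n) ^+ 2 * p ^+ 2 = A * B * Q ^+ (n + n).+1.
  by rewrite [Q ^+ _.+1]exprS exprD /Q; ring.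
have e2 : A * B * (Q ^+ n) ^+ 2 * p ^+ 4 = A * B * Q ^+ (n + n).+2.
  by rewrite [Q ^+ _.+2]exprS [Q ^+ _.+1]exprS exprD /Q; ring.
by rewrite e2 e1 e0; split; apply: sqr_neq0; apply: hAB; lia.
Qed.

(** This allows the recurrence to be solved for [T n.+1]. *)
Let up2_neq0 n : (n.+1.*2 <= M)%N -> up2 n != 0.
Proof.
move=> nM; have [[f0 f0'] [f1 f1'] [f2 f2']] := AB_neq0 n nM.
rewrite /up2 /aw_up !mulf_neq0 ?invr_eq0 ?mulf_neq0 //.
- have -> : A * p * (A * p ^+ 3) * (Q ^+ n) ^+ 2 = (A * Q ^+ n.+1) ^+ 2.
    by rewrite [Q ^+ n.+1]exprS /Q; ring.
  by rewrite hA // le_M.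
- have -> : A * p * (- B * p) * (Q ^+ n) ^+ 2 =
      - (A * B * (Q ^+ n) ^+ 2 * p ^+ 2) by ring.
  by rewrite opprK.
- have -> : A * p * (- B * p ^+ 3) * (Q ^+ n) ^+ 2 =
      - (A * B * (Q ^+ n) ^+ 2 * p ^+ 4) by ring.
  by rewrite opprK.
- have -> : A * p * (A * p ^+ 3) * (- B * p) * (- B * p ^+ 3) * (Q ^+ n) ^+ 2
      / p ^+ 4 = (A * B * Q ^+ n.+1) ^+ 2.
    by rewrite [Q ^+ n.+1]exprS /Q; field.
  by rewrite hAB // le_M.
- have -> : 1 - A * p * (A * p ^+ 3) * (- B * p) * (- B * p ^+ 3)
      * ((Q ^+ n) ^+ 2) ^+ 2 / p ^+ 4 = (1 - A * B * (Q ^+ n) ^+ 2 * p ^+ 2)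
        * (1 + A * B * (Q ^+ n) ^+ 2 * p ^+ 2) by field.
  by rewrite mulf_neq0.
- have -> : 1 - A * p * (A * p ^+ 3) * (- B * p) * (- B * p ^+ 3)
      * ((Q ^+ n) ^+ 2) ^+ 2 = (1 - A * B * (Q ^+ n) ^+ 2 * p ^+ 4)
        * (1 + A * B * (Q ^+ n) ^+ 2 * p ^+ 4) by ring.
  by rewrite mulf_neq0.
Qed.

Lemma aw_phi_quadratic n : (n.*2 <= M)%N -> T n = rho n * S n.
Proof.
(* A three-term recurrence needs two consecutive indices; at [n = 0] they coincide. *)
move=> nM; suff [] : T n = rho n * S n /\ T n.-1 = rho n.-1 * S n.-1 by [].
elim: n nM => [|n IH] nM.
  by rewrite /= /rho T0 S0 !qpochs0 expr0 divr1 !mulr1.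
have [|IH1 IH0] := IH; first by lia.
split=> //; have [[f0 f0'] [f1 f1'] [f2 f2']] := AB_neq0 n nM.
have hu : up2 n * rho n.+1 = up1 n * rho n.
  have e : 1 + A * (Q ^+ n) * p ^+ 2 = 1 + A * Q ^+ n.+1.
    by rewrite [Q ^+ n.+1]exprSr !mulrA.
  have e' : 1 + A * B * (Q ^+ n) * p ^+ 2 = 1 + A * B * Q ^+ n.+1.
    by rewrite [Q ^+ n.+1]exprSr !mulrA.
  have d0 : (1 + A * Q ^+ n.+1) * (1 + A * B * Q ^+ n.+1) != 0.
    rewrite mulf_neq0 //; last by rewrite sqr_neq0 // hAB // le_M.
    by rewrite sqr_neq0 // hA // le_M.
  apply: (mulIf d0); rewrite -[LHS]mulrA rhoS // mulrCA.
  have -> : up2 n * (A * (1 + B * Q ^+ n.+1) * (1 + Q ^+ n.+1)) =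
      up1 n * ((1 + A * Q ^+ n.+1) * (1 + A * B * Q ^+ n.+1)).
    by rewrite -e -e' !(exprSr Q n) !(mulrA _ (Q ^+ n)); apply: up_ratio.
  by rewrite mulrCA mulrA.
have hd : down2 n * rho n.-1 = down1 n * rho n.
  have e m : n = m.+1 -> down2 n * rho m = down1 n * rho n.
    move=> nm; have mM : (m.+1.*2 <= M)%N.
      by rewrite -nm (leq_trans _ nM) // leq_double.
    have d0 : (1 + A * Q ^+ n) * (1 + A * B * Q ^+ n) != 0.
      rewrite mulf_neq0 //; last by rewrite sqr_neq0 // hAB // nm le_M.
      by rewrite sqr_neq0 // hA // nm le_M.
    apply: (mulIf d0).
    have h := rhoS m mM; rewrite -nm in h; rewrite -[RHS]mulrA h.
    rewrite mulrAC.
    have -> : down2 n * ((1 + A * Q ^+ n) * (1 + A * B * Q ^+ n)) =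
        down1 n * (A * (1 + B * Q ^+ n) * (1 + Q ^+ n)) by apply: down_ratio.
    ring.
  (* At [n = 0] both downward coefficients contain the factor $1-1$. *)
  case: n e {nM IH IH1 IH0 f0 f0' f1 f1' f2 f2' hu} => [|m] e; last exact: e.
  by rewrite /down2 /down1 /aw_down expr0 expr1n subrr !(mulr0, mul0r).
have hX : A * p + (A * p)^-1 - up2 n - down2 n = p + p^-1 - up1 n - down1 n.
  by apply: diagonal_eq.
apply: (mulfI (up2_neq0 n nM)).
have -> : up2 n * T n.+1 = (z + z^-1 - (A * p + (A * p)^-1 - up2 n - down2 n))
    * T n - down2 n * T n.-1.
  have := Trec n nM; move/(canRL (subrK _)); rewrite mulrBr.
  move/(canRL (subrK _)) => ->; ring.
rewrite hX IH1 IH0.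
have -> : up2 n * (rho n.+1 * S n.+1) = rho n * (up1 n * S n.+1).
  by rewrite mulrA hu; ring.
have -> : up1 n * S n.+1 = (z + z^-1 - (p + p^-1 - up1 n - down1 n))
    * S n - down1 n * S n.-1.
  have := Srec n nM; move/(canRL (subrK _)); rewrite mulrBr.
  move/(canRL (subrK _)) => ->; ring.
rewrite mulrBr (mulrA (down2 n)) hd; ring.
Qed.

(** The prefactors in base $Q^2$ split into base $Q$ by [qpoch_sqr] and [qpoch_bisect]; after
    cancellation against [rho] only $(-ABQ^{n+1};Q)_n$ is left. *)
Lemma askey_wilson_quadratic_generic n : (n.+1.*2 <= M)%N ->
  askey_wilson_z n z (A * p) (A * p ^+ 3) (- B * p) (- B * p ^+ 3) (p ^+ 4) =
  qpoch (- A * B * Q * Q ^+ n) Q n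
  * askey_wilson_z n z p (A * p) (- B * p) (- p) Q.
Proof.
move=> nM.
have dT := qpochs_neq0_le _ _ _ _ _ (leqnSn n) (dT_neq0 n nM).
have dS : qpochs [:: Q; p * (A * p); p * (- B * p); p * - p] Q n != 0.
  by apply: qpochs_neq0_le (leqnSn n) (dS_neq0 n _); lia.
move: dT dS; rewrite !(qpochs_cons _ _ [:: _; _; _]) !mulf_eq0 !negb_or.
move=> /andP[_ dT] /andP[_ dS].
rewrite !askey_wilson_phiE ?expf_neq0 // -/(T n) -/(S n) aw_phi_quadratic;
  last by lia.
have Q2 : p ^+ 4 = Q ^+ 2 by rewrite /Q -exprM.
have eA : qpoch (A * p * (A * p ^+ 3)) (p ^+ 4) n =
    qpoch (A * Q) Q n * qpoch (- A * Q) Q n.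
  rewrite mulNr -qpoch_sqr -Q2; congr (qpoch _ _ _).
  by rewrite /Q; ring.
have eAB : qpoch (A * p * (- B * p)) (p ^+ 4) n
      * qpoch (A * p * (- B * p ^+ 3)) (p ^+ 4) n =
    qpoch (- A * B * Q) Q n * qpoch (- A * B * Q * Q ^+ n) Q n.
  rewrite -qpochD -qpoch_bisect Q2.
  by congr (qpoch _ _ _ * qpoch _ _ _); rewrite /Q; ring.
have e1 : p * (A * p) = A * Q by rewrite /Q; ring.
have e2 : p * (- B * p) = - B * Q by rewrite /Q; ring.
have e3 : p * - p = - Q by rewrite /Q; ring.
have dA : qpoch (- A * Q) Q n != 0.
  apply: qpoch_neq0 => j jn; rewrite one_subN_shift.
  by rewrite sqr_neq0 // hA //; lia.
have dAB : qpoch (- A * B * Q) Q n != 0.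
  apply: qpoch_neq0 => j jn; rewrite (mulNr A) one_subN_shift.
  by rewrite sqr_neq0 // hAB //; lia.
rewrite /rho !qpochsE eAB eA e1 e2 e3 exprMn.
by field; rewrite dA dAB !expf_neq0.
Qed.
End Quadratic.

(** * Polynomial functions and extension of identities from generic arguments *)

Section Density.
Variable F : numFieldType.

Definition polyfun (f : F -> F) := exists P : {poly F}, forall t, f t = P.[t].

Lemma polyfun_ext f g : f =1 g -> polyfun f -> polyfun g.
Proof. by move=> e [P h]; exists P => t; rewrite -e h. Qed.

Lemma polyfun_cst c : polyfun (fun=> c).
Proof. by exists c%:P => t; rewrite hornerC. Qed.

Lemma polyfun_id : polyfun id.
Proof. by exists 'X => t; rewrite hornerX. Qed.

Lemma polyfunD f g : polyfun f -> polyfun g -> polyfun (fun t => f t + g t).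
Proof. by move=> [P hP] [H hH]; exists (P + H) => t; rewrite hornerD hP hH. Qed.

Lemma polyfunM f g : polyfun f -> polyfun g -> polyfun (fun t => f t * g t).
Proof. by move=> [P hP] [H hH]; exists (P * H) => t; rewrite hornerM hP hH. Qed.

Lemma polyfunN f : polyfun f -> polyfun (fun t => - f t).
Proof. by move=> [P hP]; exists (- P) => t; rewrite hornerN hP. Qed.

Lemma polyfunX f n : polyfun f -> polyfun (fun t => f t ^+ n).
Proof. by move=> [P hP]; exists (P ^+ n) => t; rewrite horner_exp hP. Qed.

Lemma polyfun_sum (I : Type) (r : seq I) (f : I -> F -> F) :
  (forall i, polyfun (f i)) -> polyfun (fun t => \sum_(i <- r) f i t).
Proof.
move=> h; elim: r => [|i r IH].
  by apply: polyfun_ext (polyfun_cst 0) => t; rewrite big_nil.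
apply: polyfun_ext (polyfunD _ _ (h i) IH) => t.
by rewrite big_cons.
Qed.

Lemma polyfun_prod (I : Type) (r : seq I) (f : I -> F -> F) :
  (forall i, polyfun (f i)) -> polyfun (fun t => \prod_(i <- r) f i t).
Proof.
move=> h; elim: r => [|i r IH].
  by apply: polyfun_ext (polyfun_cst 1) => t; rewrite big_nil.
apply: polyfun_ext (polyfunM _ _ (h i) IH) => t.
by rewrite big_cons.
Qed.

Lemma polyfun_qpoch a q n : polyfun a -> polyfun (fun t => qpoch (a t) q n).
Proof.
move=> ha; apply: polyfun_prod => k; apply: polyfunD; first exact: polyfun_cst.
by apply/polyfunN/polyfunM => //; apply: polyfun_cst.
Qed.

(** In characteristic 0 the integers $0,1,\dots$ supply more distinct roots than the degree
    allows. *)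
Lemma poly_eq0 (P : {poly F}) : (forall t, P.[t] = 0) -> P = 0.
Proof.
move=> h; apply/eqP; apply: contraT => /max_poly_roots.
move=> /(_ [seq i%:R | i <- iota 0 (size P)]) hP.
suff : (size P < size P)%N by rewrite ltnn.
rewrite -{1}(size_iota 0 (size P)) -(size_map (fun i => i%:R : F)) hP //.
  by apply/allP => t _; apply/rootP.
rewrite map_inj_uniq ?iota_uniq // => i j /eqP.
by rewrite eqr_nat => /eqP.
Qed.

(** The product of [t], [g t] and [f t] vanishes identically, and [g 0 != 0] shows that the
    polynomial of [g] is nonzero. *)
Lemma polyfun_density f g : polyfun f -> polyfun g -> g 0 != 0 ->
  (forall t, t != 0 -> g t != 0 -> f t = 0) -> forall t, f t = 0.
Proof.
move=> [P hP] [G hG] g0 h t.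
have /eqP : 'X * G * P = 0.
  apply: poly_eq0 => x; rewrite !hornerM hornerX -hG -hP.
  have [->|x0] := eqVneq x 0; first by rewrite !mul0r.
  have [->|gx0] := eqVneq (g x) 0; first by rewrite mulr0 mul0r.
  by rewrite h ?mulr0.
rewrite !mulf_eq0 polyX_eq0 /= => /orP[/eqP G0|/eqP P0].
  by move: g0; rewrite hG G0 horner0 eqxx.
by rewrite hP P0 horner0.
Qed.

End Density.

(** * Removal of the genericity assumption from the quadratic transformation *)

Section Transformation.
Variable F : numFieldType.
Implicit Types p A B q z : F.

(** The Askey-Wilson polynomial without the factor $a^{-n}$, hence polynomial in [a], [b], [c],
    [d]. *)
Definition aw_sum n z a b c d q : F := \sum_(k < n.+1)
  qpochs [:: q ^- n; q ^ (n%:Z - 1) * a * b * c * d; a * z; a * z^-1] q k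
  / qpoch q q k
  * qpochs [:: a * b * q ^+ k; a * c * q ^+ k; a * d * q ^+ k] q (n - k)
  * q ^+ k.

Lemma polyfun_aw_sum n z q (a b c d : F -> F) :
  polyfun F a -> polyfun F b -> polyfun F c -> polyfun F d ->
  polyfun F (fun t => aw_sum n z (a t) (b t) (c t) (d t) q).
Proof.
move=> ha hb hc hd; apply: polyfun_sum => k.
have hcst x : polyfun F (fun=> x) by apply: polyfun_cst.
have hq x m : polyfun F x -> polyfun F (fun t => qpoch (x t) q m).
  exact: polyfun_qpoch.
have hM := polyfunM F.
apply: (hM _ _ _ (hcst _)); apply: (hM).
  apply: (hM _ _ _ (hcst _)).
  apply: (polyfun_ext F (fun t => qpoch (q ^- n) q k
    * (qpoch (q ^ (n%:Z - 1) * a t * b t * c t * d t) q k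
       * (qpoch (a t * z) q k * qpoch (a t * z^-1) q k)))).
    by move=> t; rewrite !qpochsE.
  do !apply: (hM) => //; apply: hq; do !apply: (hM) => //.
apply: (polyfun_ext F (fun t => qpoch (a t * b t * q ^+ k) q (n - k)
  * (qpoch (a t * c t * q ^+ k) q (n - k)
     * qpoch (a t * d t * q ^+ k) q (n - k)))).
  by move=> t; rewrite !qpochsE.
do !apply: (hM) => //; apply: hq; do !apply: (hM) => //.
Qed.

Lemma askey_wilson_quadratic n p A B z (Q := p ^+ 2) :
  p != 0 -> A != 0 -> z != 0 -> (forall j, 1 - Q ^+ j.+1 != 0) ->
  askey_wilson_z n z (A * p) (A * p ^+ 3) (- B * p) (- B * p ^+ 3) (p ^+ 4) =
  qpoch (- A * B * Q * Q ^+ n) Q n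
  * askey_wilson_z n z p (A * p) (- B * p) (- p) Q.
Proof.
move=> p0 A0 z0 Q1; pose M := n.+1.*2.
(* The difference of the two sides at [(t * A, t * B)], multiplied by $p^n(tAp)^n$ to clear the
   negative powers. *)
pose f t := p ^+ n * aw_sum n z (t * A * p) (t * A * p ^+ 3) (- (t * B) * p)
    (- (t * B) * p ^+ 3) (p ^+ 4)
  - (t * A * p) ^+ n * qpoch (- (t * A) * (t * B) * Q * Q ^+ n) Q n
    * aw_sum n z p (t * A * p) (- (t * B) * p) (- p) Q.
(* [g t != 0] expresses genericity of [(t * A, t * B)], and [g 0 = 1]. *)
pose g t := \prod_(j < M.+1) ((1 - (t * A * Q ^+ j) ^+ 2)
  * (1 - (t * B * Q ^+ j) ^+ 2) * (1 - (t * A * (t * B) * Q ^+ j) ^+ 2)).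
have hcst x : polyfun F (fun=> x) by apply: polyfun_cst.
have hM := polyfunM F.
have hN := polyfunN F.
have hid : polyfun F (fun t => t) by apply: polyfun_id.
have hf : polyfun F f.
  apply: polyfunD; last apply: (hN); apply: (hM) => //.
  - by apply: polyfun_aw_sum; do ?[apply: (hM) => //; try apply: (hN)];
      do ?apply: (hM).
  - apply: (hM).
      by apply: polyfunX; do !apply: (hM).
    apply: polyfun_qpoch; do !apply: (hM) => //.
    by apply: (hN); apply: (hM).
  - by apply: polyfun_aw_sum => //; do ?[apply: (hM) => //; try apply: (hN)];
      do ?apply: (hM).
have hg : polyfun F g.
  apply: polyfun_prod => j.
  have h1 x : polyfun F x -> polyfun F (fun t => 1 - x t ^+ 2).
    by move=> hx; apply: polyfunD => //; apply: (hN); apply: polyfunX.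
  by do !apply: (hM); apply: h1; do !apply: (hM).
have g0 : g 0 != 0.
  rewrite /g big1 ?oner_neq0 // => j _.
  by rewrite !mul0r expr0n /= subr0 !mulr1.
have fg t : t != 0 -> g t != 0 -> f t = 0.
  move=> t0 /prodf_neq0 gt.
  have tA0 : t * A != 0 by rewrite mulf_neq0.
  have gj j : (j <= M)%N -> [/\ 1 - (t * A * Q ^+ j) ^+ 2 != 0,
      1 - (t * B * Q ^+ j) ^+ 2 != 0
    & 1 - (t * A * (t * B) * Q ^+ j) ^+ 2 != 0].
    rewrite -ltnS => jM; have := gt (Ordinal jM) isT.
    by rewrite !mulf_eq0 !negb_or => /andP[/andP[]].
  have := @askey_wilson_quadratic_generic F p (t * A) (t * B) z p0 tA0 z0 Q1 M
    (fun j h => let: And3 x _ _ := gj j h in x)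
    (fun j h => let: And3 _ x _ := gj j h in x)
    (fun j h => let: And3 _ _ x := gj j h in x) n (leqnn _).
  rewrite /askey_wilson_z -/(aw_sum _ _ _ _ _ _ _) -/(aw_sum n z p _ _ _ _).
  move=> e; apply/eqP; rewrite subr_eq0; apply/eqP.
  have a0 : (t * A * p) ^+ n != 0 by rewrite expf_neq0 // mulf_neq0.
  have b0 : p ^+ n != 0 by rewrite expf_neq0.
  apply: (mulfI (invr_neq0 a0)); rewrite mulrCA e -/Q.
  by field; rewrite a0 b0.
have := polyfun_density F f g hf hg g0 fg 1; rewrite /f !mul1r => /subr0_eq e.
have a0 : (A * p) ^+ n != 0 by rewrite expf_neq0 // mulf_neq0.
have b0 : p ^+ n != 0 by rewrite expf_neq0.
rewrite /askey_wilson_z -/(aw_sum _ _ _ _ _ _ _) -/(aw_sum n z p _ _ _ _).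
apply: (mulfI b0); rewrite mulrCA e.
by field; rewrite a0 b0.
Qed.

End Transformation.

(** * q-Racah polynomials, their duality, and the identity with free parameters *)

Section QRacah.
Variable F : fieldType.
Implicit Types p A B a b c d q : F.

Lemma qRacah_den_sym a b c d q k :
  qRacah_den c d a b q k = qRacah_den a b c d q k.
Proof. by rewrite /qRacah_den !qpochsE (mulrAC q d); ring. Qed.

(** Duality of degree and variable: the exchange only permutes the factors within each term. *)
Lemma qRacah_m_sym n m a b c d q :
  qRacah_m m n c d a b q = qRacah_m n m a b c d q.
Proof.
rewrite /qRacah_m minnC; apply: eq_bigr => k _.
by rewrite qRacah_den_sym !qpochsE; congr (_ / _ * _); ring.
Qed.

(** At $z=pQ^m$ the entries $az$, $a/z$ with $a=p$ become $Q^{m+1}$ and $Q^{-m}$, which are the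
    q-Racah entries for $\bar\gamma=\bar\delta=-1$; the second one cuts the sum at $k=m$. *)
Lemma askey_wilson_qRacah n m p A B (Q := p ^+ 2) : p != 0 ->
  (forall k, (k <= minn m n)%N -> qRacah_den A B (-1) (-1) Q k != 0) ->
  askey_wilson_z n (p * Q ^+ m) p (A * p) (- B * p) (- p) Q =
  p ^- n * qpochs [:: A * Q; - B * Q; - Q] Q n
  * qRacah_m n m A B (-1) (-1) Q.
Proof.
move=> p0 hden.
have Q0 : Q != 0 by rewrite expf_neq0.
have Qm0 : Q ^+ m != 0 by rewrite expf_neq0.
rewrite /askey_wilson_z -[RHS]mulrA; congr (_ * _).
rewrite /qRacah_m (big_ord_widen n.+1 (fun k =>
  qpochs [:: Q ^- n; Q ^+ n.+1 * A * B; Q ^- m; Q ^+ m.+1 * -1 * -1] Q k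
  / qRacah_den A B (-1) (-1) Q k * Q ^+ k)) ?ltnS ?geq_minr //.
rewrite [in RHS]big_mkcond mulr_sumr; apply: eq_bigr => k _ /=.
have kn : (k <= n)%N by rewrite -ltnS.
have z1 : p * (p * Q ^+ m) = Q ^+ m.+1 * -1 * -1.
  by rewrite [Q ^+ m.+1]exprS /Q; ring.
have z2 : p * (p * Q ^+ m)^-1 = Q ^- m by field; rewrite Qm0 p0.
case: ifPn => [|]; rewrite ltnS leq_min kn andbT; last first.
  rewrite -ltnNge => mk; rewrite !qpochsE z2 (qpoch_qVn_eq0 Q0 mk).
  by rewrite !(mulr0, mul0r).
move=> km; have := hden k; rewrite leq_min km kn => /(_ isT).
have e x : qpoch x Q n = qpoch x Q k * qpoch (x * Q ^+ k) Q (n - k).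
  by rewrite -qpochD subnKC.
rewrite /qRacah_den !qpochsE !e z1 z2.
have -> : p * (A * p) = A * Q by rewrite /Q; ring.
have -> : p * (- B * p) = - B * Q by rewrite /Q; ring.
have -> : p * - p = - Q by rewrite /Q; ring.
have -> : Q ^ (n%:Z - 1) * p * (A * p) * (- B * p) * - p = Q ^+ n.+1 * A * B.
  by rewrite expfzDr // -exprnP exprN1 [Q ^+ n.+1]exprS /Q; field.
have -> : Q * A = A * Q by rewrite mulrC.
have -> : Q * B * -1 = - B * Q by ring.
have -> : Q * -1 = - Q by ring.
rewrite !mulf_eq0 !negb_or => /and4P[d1 d2 d3 d4].
by field; rewrite d1 d2 d3 d4.
Qed.

End QRacah.

(** Here [p], [A], [B] stand for $q^{1/4}$, $q^{\alpha/2}$, $q^{\beta/2}$, each multiplied by the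
    chosen sign. *)
Lemma cqJacobi_algebraic (F : numFieldType) (n m : nat) (p A B : F)
    (Q := p ^+ 2) (q := p ^+ 4) :
  p != 0 -> A != 0 -> (forall j, 1 - Q ^+ j.+1 != 0) ->
  qpochs [:: q; - (A * B * Q); - (A * B * q)] q n != 0 ->
  (forall k, (k <= minn m n)%N -> qRacah_den A B (-1) (-1) Q k != 0) ->
  (A * p) ^+ n / qpochs [:: q; - (A * B * Q); - (A * B * q)] q n
  * askey_wilson_z n (p * Q ^+ m) (A * p) (A * p ^+ 3) (- B * p)
      (- B * p ^+ 3) q =
  A ^+ n * qpochs [:: A * Q; - B * Q] Q n / qpochs [:: Q; - (A * B * Q)] Q n
  * qRacah_m n m A B (-1) (-1) Q.
Proof.
move=> p0 A0 Q1 hD hden.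
have Q0 : Q != 0 by rewrite expf_neq0.
rewrite /q askey_wilson_quadratic ?mulf_neq0 ?expf_neq0 //.
rewrite askey_wilson_qRacah // -/Q -/q.
have q2 : q = Q ^+ 2 by rewrite /Q -exprM.
(* The last two entries combine to $(-ABQ;Q)_{2n}$, whose second half cancels the factor of the
   quadratic transformation. *)
have e : qpochs [:: q; - (A * B * Q); - (A * B * q)] q n =
    qpoch Q Q n * qpoch (- Q) Q n * (qpoch (- (A * B * Q)) Q n
      * qpoch (- A * B * Q * Q ^+ n) Q n).
  rewrite !qpochsE q2 -qpoch_sqr; congr (_ * _).
  have -> : - (A * B * Q ^+ 2) = - (A * B * Q) * Q by ring.
  rewrite qpoch_bisect qpochD; congr (_ * qpoch _ _ _); ring.
rewrite e in hD *; move: hD; rewrite !mulf_eq0 !negb_or.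
move=> /andP[/andP[d1 d2] /andP[d3 d4]].
rewrite !qpochsE exprMn; field.
by rewrite d1 d2 d3 d4 expf_neq0.
Qed.

(** * Complex powers of $q$ and the specialisation to them *)

Section ComplexPowers.
Variable R : realType.
Implicit Types x y logq : R[i].

Lemma cexpD x y : cexp (x + y) = cexp x * cexp y.
Proof.
case: x y => [a b] [c d]; rewrite /cexp /= expRD cosD sinD.
by apply/eqP; rewrite eq_complex /=; apply/andP; split; apply/eqP; ring.
Qed.

Lemma cexp0 : cexp (0 : R[i]) = 1.
Proof. by rewrite /cexp /= expR0 cos0 sin0 mulr1 mulr0. Qed.

Lemma cpowD logq x y : cpow logq (x + y) = cpow logq x * cpow logq y.
Proof. by rewrite /cpow mulrDl cexpD. Qed.

Lemma cpow0 logq : cpow logq 0 = 1.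
Proof. by rewrite /cpow mul0r cexp0. Qed.

Lemma cpow_neq0 logq x : cpow logq x != 0.
Proof.
apply/eqP => e; have := cpow0 logq; rewrite -(subrr x) cpowD e mul0r.
by move/esym/eqP; rewrite oner_eq0.
Qed.

Lemma cpowV logq x : (cpow logq x)^-1 = cpow logq (- x).
Proof.
apply: (mulfI (cpow_neq0 logq x)).
by rewrite divff ?cpow_neq0 // -cpowD subrr cpow0.
Qed.

Lemma cpowX logq x n : cpow logq x ^+ n = cpow logq (x * n%:R).
Proof.
elim: n => [|n IH]; first by rewrite mulr0 cpow0.
by rewrite exprS IH -cpowD -nat1r mulrDr mulr1.
Qed.

End ComplexPowers.

(* [eps] is the chosen sign: [1] for the upper signs, [-1] for the lower. *)
Theorem theorem2p10 (R : realType) (m n N : nat)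
  (q logq alpha beta eps : R[i])
  (hq0 : q != 0) (hq1 : `|q| != 1) (hlogq : cexp logq = q)
  (hsign : (eps = 1 /\ alpha = - N%:R - 1) \/ (eps = -1 /\ beta = - N%:R - 1)) :
  let qp := cpow logq in
  let Q := qp (1 / 2) in
  let x := eps * (1 / 2 * (qp (1 / 4 + m%:R / 2) + qp (- (1 / 4) - m%:R / 2))) in
  let den := qpochs [:: Q; - qp ((alpha + beta + 1) / 2)] Q n in
  let pref := (eps * qp (alpha / 2)) ^+ n
    * qpochs [:: eps * qp ((alpha + 1) / 2); - eps * qp ((beta + 1) / 2)] Q n
    / den in
  qpochs [:: q; - qp ((alpha + beta + 1) / 2); - qp ((alpha + beta + 2) / 2)] q n
    != 0 ->
  den != 0 ->
  ((n <= N)%N ->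
   (forall k : nat, (k <= minn m n)%N ->
      qRacah_den (eps * qp (alpha / 2)) (eps * qp (beta / 2)) (-1) (-1) Q k
        != 0) ->
   cqJacobi n alpha beta x logq =
   pref * qRacah n (qp (- (m%:R / 2)) + qp ((m%:R + 1) / 2))
            (eps * qp (alpha / 2)) (eps * qp (beta / 2)) (-1) (-1) Q)
  /\
  ((m <= N)%N ->
   (forall k : nat, (k <= minn m n)%N ->
      qRacah_den (-1) (-1) (eps * qp (alpha / 2)) (eps * qp (beta / 2)) Q k
        != 0) ->
   cqJacobi n alpha beta x logq =
   pref * qRacah m (qp (- (n%:R / 2)) + qp ((alpha + beta + n%:R + 1) / 2))
            (-1) (-1) (eps * qp (alpha / 2)) (eps * qp (beta / 2)) Q).
Proof.
move=> qp Q x den pref hD hden.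
have heps : eps = 1 \/ eps = -1 by case: hsign => -[-> _]; [left|right].
have eps2 : eps ^+ 2 = 1 by case: heps => ->; ring.
pose p := qp (1 / 4); pose A := qp (alpha / 2); pose B := qp (beta / 2).
have qpD s t : qp (s + t) = qp s * qp t by apply: cpowD.
have qpX s k : qp s ^+ k = qp (s * k%:R) by apply: cpowX.
have qpV s : (qp s)^-1 = qp (- s) by apply: cpowV.
have qp0 s : qp s != 0 by apply: cpow_neq0.
have eQ : Q = p ^+ 2 by rewrite qpX; congr qp; field.
have eq4 : q = p ^+ 4.
  by rewrite -hlogq qpX /qp /cpow; congr cexp; field.
have Q1 j : 1 - Q ^+ j.+1 != 0.
  (* Since $q=Q^2$, the relation $Q^{j+1}=1$ would give $|q|^{j+1}=1$, hence $|q|=1$. *)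
  rewrite eQ; apply: contraNneq hq1 => /eqP; rewrite subr_eq0 => /eqP e.
  rewrite eq4 -(pexpr_eq1 (n := j.+1)) // -normrX -exprM mulnC.
  have -> : (j.+1 * 4 = 2 * j.+1 * 2)%N by lia.
  by rewrite 2!exprM -e expr1n normr1.
pose w := p * Q ^+ m; pose z := eps * w.
have w0 : w != 0 by rewrite mulf_neq0 ?expf_neq0 // /p /Q.
have eps0 : eps != 0.
  by case: heps => ->; rewrite ?oppr_eq0 oner_eq0.
have xE : x = (z + z^-1) / 2.
  rewrite /x.
  have -> : qp (1 / 4 + m%:R / 2) = w.
    by rewrite qpD /w qpX; congr (_ * qp _); field.
  have -> : qp (- (1 / 4) - m%:R / 2) = w^-1.
    by rewrite /w /Q qpX -qpD qpV; congr qp; field.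
  by rewrite /z; case: heps => ->; field.
have f1 : qp ((alpha + beta + 1) / 2) = A * B * Q.
  by rewrite -!qpD; congr qp; field.
have f2 : qp ((alpha + beta + 2) / 2) = A * B * q.
  by rewrite eq4 qpX -!qpD; congr qp; field.
have f3 : qp ((alpha + 1) / 2) = A * Q by rewrite -!qpD; congr qp; field.
have f4 : qp ((beta + 1) / 2) = B * Q by rewrite -!qpD; congr qp; field.
have f5 : qp (alpha / 2 + 1 / 4) = A * p by rewrite -!qpD; congr qp; field.
have f6 : qp (alpha / 2 + 3 / 4) = A * p ^+ 3.
  by rewrite qpX -!qpD; congr qp; field.
have f7 : qp (beta / 2 + 1 / 4) = B * p by rewrite -!qpD; congr qp; field.
have f8 : qp (beta / 2 + 3 / 4) = B * p ^+ 3.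
  by rewrite qpX -!qpD; congr qp; field.
have f9 : qp ((alpha / 2 + 1 / 4) * n%:R) = (A * p) ^+ n by rewrite -f5 qpX.
have f10 : qp (- (m%:R / 2)) + qp ((m%:R + 1) / 2) = qRacah_mu (-1) (-1) Q m.
  rewrite /qRacah_mu !qpX qpV mulrN1 mulrN1 opprK.
  by congr (qp _ + qp _); field.
have f11 : qp (- (n%:R / 2)) + qp ((alpha + beta + n%:R + 1) / 2) =
    qRacah_mu (eps * A) (eps * B) Q n.
  have -> : qRacah_mu (eps * A) (eps * B) Q n =
      Q ^- n + A * (B * Q ^+ n.+1).
    by rewrite /qRacah_mu; case: heps => ->; ring.
  by rewrite !qpX qpV -!qpD; congr (qp _ + qp _); field.
have [Q0 p0 A0] : [/\ Q != 0, p != 0 & A != 0] by split; apply: qp0.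
(* Products of two signed quantities lose the sign, so the Jacobi parameters and both bases are
   unchanged, while [p' * Q ^+ m] becomes [z]. *)
pose p' := eps * p; pose A' := eps * A; pose B' := eps * B.
have main : (forall k, (k <= minn m n)%N ->
      qRacah_den A' B' (-1) (-1) Q k != 0) ->
    cqJacobi n alpha beta x logq = pref * qRacah_m n m A' B' (-1) (-1) Q.
  have := @cqJacobi_algebraic _ n m p' A' B'; cbv zeta.
  have -> : p' ^+ 2 = Q by rewrite exprMn eps2 mul1r eQ.
  have -> : p' ^+ 4 = q by rewrite exprMn (exprM eps 2 2) eps2 expr1n mul1r eq4.
  have -> : A' * p' = A * p by rewrite /A' /p'; case: heps => ->; ring.
  have -> : A' * p' ^+ 3 = A * p ^+ 3.
    by rewrite /A' /p'; case: heps => ->; ring.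
  have -> : - B' * p' = - (B * p) by rewrite /B' /p'; case: heps => ->; ring.
  have -> : - B' * p' ^+ 3 = - (B * p ^+ 3).
    by rewrite /B' /p'; case: heps => ->; ring.
  have -> : A' * B' = A * B by rewrite /A' /B'; case: heps => ->; ring.
  have -> : p' * Q ^+ m = z by rewrite /p' /z /w mulrA.
  rewrite -f9 -f1 -f2 => H hR.
  rewrite /cqJacobi /= hlogq -/qp xE askey_wilsonE ?mulf_neq0 ?expf_neq0 //.
  rewrite f5 f6 f7 f8 (H (mulf_neq0 eps0 p0) (mulf_neq0 eps0 A0) Q1 hD hR).
  rewrite /pref /den f3 f4 mulrA.
  by have -> : - eps * (B * Q) = - B' * Q by rewrite /B'; ring.
split=> _ hd.
  by rewrite f10 qRacahE //; apply: main.
(* Duality turns the polynomial of degree [m] in (b) into the one of degree [n] in (a). *)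
rewrite f11 qRacahE // qRacah_m_sym; apply: main => k /hd.
by rewrite qRacah_den_sym.
Qed.
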